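(* Let $\varepsilon>0$ be a real number. (a) There is a constant $K=K(\varepsilon)$, depending only on $\varepsilon$, such that $T(n,m)\le K$ for all integers $n\ge m\ge 1$ with $m>\left(\frac29+\varepsilon\right)n$. (b) There is a real number $\delta=\delta(\varepsilon)>0$, depending only on $\varepsilon$, such that $T(n,m)\ge (1+\delta)^n$ for all integers $n\ge m\ge 1$ with $m<\left(\frac29-\varepsilon\right)n$.
   Context: Three words $x,y,z\in\{0,1,2\}^n$ triffer at position $i$ if $\{x_i,y_i,z_i\}=\{0,1,2\}$. For integers $n\ge m\ge 1$, a code $C\subseteq\{0,1,2\}^n$ is $m$-trifferent if any three distinct codewords of $C$ triffer in at least $m$ positions. $T(n,m)$ denotes the largest size of an $m$-trifferent code $C\subseteq\{0,1,2\}^n$. *)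

(* Defs.v *)
From mathcomp Require Import all_boot.
Set Implicit Arguments.
Unset Strict Implicit.
Unset Printing Implicit Defensive.

Notation word n := {ffun 'I_n -> 'I_3}.

Definition triffer (n : nat) (x y z : word n) (i : 'I_n) : bool :=
  [set x i; y i; z i] == [set: 'I_3].

Definition trifferent (n m : nat) (C : {set word n}) : bool :=
  [forall x in C, forall y in C, forall z in C,
    [&& x != y, y != z & x != z] ==> (m <= #|[set i | triffer x y z i]|)].

(* The maximum ranges over a nonempty family: the empty code is m-trifferent,
   as is every code with at most two codewords. *)
Definition T (n m : nat) : nat :=
  \max_(C : {set word n} | trifferent m C) #|C|.

(* Main.v *)
(* (a) Plotkin-type double counting: at each position at most 6 (M/3)^3 = 2/9 M^3
   ordered triples of an M-word code triffer, while each of the at least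
   M^3 - 3 M^2 ordered triples of distinct words triffers m times; so
   m (M - 3) <= 2/9 n M.

   (b) For a fixed word x and t = 1 - eps, the sum of t^#triffer over all pairs
   (y, z) is (7 + 2 t)^n, so only an exponentially small fraction q^2 of the
   pairs makes a bad triple with x (one with fewer than m triffering positions).
   Call (x, y) heavy if more than q 3^n words z complete it to a bad triple;
   by Markov, x lies in at most q 3^n heavy pairs. Every word is blocked by a
   maximal code of size M without heavy pairs or bad triples, hence
   3^n <= (M + M^2) q 3^n. *)
Require Import Defs.
From mathcomp Require Import all_boot all_order all_algebra.
From mathcomp Require Import reals.
From mathcomp Require Import sequences exp ring lra.
Set Implicit Arguments.
Unset Strict Implicit.
Unset Printing Implicit Defensive.
Import Order.TTheory GRing.Theory Num.Theory.
Local Open Scope ring_scope.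

(** * Triffering as distinctness of letters, and two-word codes *)

Lemma trifferE (n : nat) (x y z : word n) (i : 'I_n) :
  triffer x y z i = [&& x i != y i, y i != z i & x i != z i].
Proof.
rewrite /triffer eqEcard subsetT cardsT card_ord /= setUC cardsU1 cards2 !inE.
rewrite negb_or ![z i == _]eq_sym.
by case: (x i == y i); case: (y i == z i); case: (x i == z i).
Qed.

Lemma triffer_swap (n : nat) (x y z : word n) : triffer x y z =1 triffer y x z.
Proof. by move=> i; rewrite /triffer (setUC [set x i]). Qed.

Lemma triffer_rot (n : nat) (x y z : word n) : triffer x y z =1 triffer y z x.
Proof. by move=> i; rewrite /triffer -setUA setUC. Qed.

Lemma leq_T (n m : nat) (C : {set word n}) : trifferent m C -> (#|C| <= T n m)%N.
Proof. by move=> hC; apply: (leq_bigmax_cond (F := fun C : {set word n} => #|C|)). Qed.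

(** Two constant words contain no three distinct codewords. [T_lower] uses this bound to absorb
    [t + t ^+ 2] into [t ^+ 3]. *)
Lemma T_ge2 (n m : nat) : (0 < n)%N -> (2 <= T n m)%N.
Proof.
move=> n_gt0; pose c a : word n := [ffun=> a].
have c01 : c 0 != c 1.
  by apply/eqP => /ffunP/(_ (Ordinal n_gt0)); rewrite !ffunE.
suff /leq_T : trifferent m [set c 0; c 1] by rewrite cards2 c01.
apply/forall_inP => x /set2P hx; apply/forall_inP => y /set2P hy.
apply/forall_inP => z /set2P hz; apply/implyP.
by case: hx => ->; case: hy => ->; case: hz => ->; rewrite ?eqxx ?andbF.
Qed.

(** * Double counting of triffering triples *)

Section UpperBound.
Variables (R : realFieldType) (n : nat) (C : {set word n}).

Let letter_card (i : 'I_n) (a : 'I_3) : R := #|[set x in C | x i == a]|%:R.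

Lemma sum_by_letter (i : 'I_n) (F : 'I_3 -> R) :
  \sum_(x in C) F (x i) = \sum_a letter_card i a * F a.
Proof.
rewrite (partition_big (fun x : word n => x i) predT) //=.
apply: eq_bigr => a _; rewrite (eq_bigr (fun=> F a)) => [|x /andP[_ /eqP->] //].
rewrite sumr_const -mulr_natl /letter_card; congr (_%:R * _).
by apply: eq_card => x; rewrite !inE.
Qed.

Lemma amgm3 (a b c : R) : 0 <= a -> 0 <= b -> 0 <= c ->
  27 * (a * b * c) <= (a + b + c) ^+ 3.
Proof.
move=> a0 b0 c0; rewrite -subr_ge0.
(* The difference of the two sides is half the sum of the terms [(a + b + c) * (a - b) ^+ 2] plus
   three times the sum of the terms [a * (b - c) ^+ 2], over the three choices each. *)
have := mulr_ge0 a0 (sqr_ge0 (b - c)); have := mulr_ge0 b0 (sqr_ge0 (a - c)).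
have := mulr_ge0 c0 (sqr_ge0 (a - b)).
have := mulr_ge0 (addr_ge0 (addr_ge0 a0 b0) c0) (sqr_ge0 (a - b)).
have := mulr_ge0 (addr_ge0 (addr_ge0 a0 b0) c0) (sqr_ge0 (a - c)).
have := mulr_ge0 (addr_ge0 (addr_ge0 a0 b0) c0) (sqr_ge0 (b - c)).
lra.
Qed.

(** If the three letters occur [a], [b], [c] times at position [i], exactly [6 * a * b * c] ordered
    triples triffer there; [amgm3] applies since [a + b + c] is the code size. *)
Lemma sum_triffer_at_le (i : 'I_n) :
  \sum_(x in C) \sum_(y in C) \sum_(z in C) (triffer x y z i)%:R
    <= 2 / 9 * #|C|%:R ^+ 3 :> R.
Proof.
pose D a b c : R := [&& a != b, b != c & a != c :> 'I_3]%:R.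
rewrite (eq_bigr (fun x : word n =>
  (fun a => \sum_b letter_card i b * \sum_c letter_card i c * D a b c) (x i))).
  rewrite (sum_by_letter i (fun a =>
    \sum_b letter_card i b * \sum_c letter_card i c * D a b c)).
  have -> : #|C|%:R = letter_card i 0 + letter_card i 1 + letter_card i 2 :> R.
    rewrite -sumr_const (sum_by_letter i (fun=> 1)) !big_ord_recl big_ord0.
    rewrite !mulr1 addr0 addrA.
    by congr (letter_card i _ + letter_card i _ + letter_card i _); apply: val_inj.
  have := @amgm3 (letter_card i 0) (letter_card i 1) (letter_card i 2).
  rewrite !ler0n => /(_ isT isT isT).
  rewrite !big_ord_recl !big_ord0 /D /=.
  have -> : lift ord0 ord0 = 1 :> 'I_3 by apply: val_inj.
  have -> : lift ord0 (lift ord0 ord0) = 2 :> 'I_3 by apply: val_inj.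
  have -> : ord0 = 0 :> 'I_3 by apply: val_inj.
  rewrite /=.
  lra.
move=> x _; rewrite -sum_by_letter; apply: eq_bigr => y _.
rewrite -sum_by_letter; apply: eq_bigr => z _.
by rewrite trifferE.
Qed.

Lemma trifferent_count (m : nat) : trifferent m C ->
  m%:R * (#|C|%:R ^+ 3 - 3 * #|C|%:R ^+ 2) <= n%:R * (2 / 9 * #|C|%:R ^+ 3) :> R.
Proof.
move=> hC.
pose M : R := #|C|%:R.
have sum1 (a : R) : \sum_(x in C) a = M * a by rewrite sumr_const -mulr_natl.
have sumeq (x : word n) : x \in C -> \sum_(y in C) (x == y)%:R = 1 :> R.
  move=> xC; rewrite (bigD1 x) //= eqxx big1 ?addr0 // => y /andP[_ yx].
  by rewrite eq_sym (negbTE yx).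
(* One minus the three equality indicators is 1 on distinct triples and at most 0 on all others, so
   it bounds the indicator of distinctness from below; it sums exactly to [M ^+ 3 - 3 * M ^+ 2]. *)
have -> : m%:R * (M ^+ 3 - 3 * M ^+ 2) = \sum_(x in C) \sum_(y in C) \sum_(z in C)
    m%:R * (1 - (x == y)%:R - (y == z)%:R - (x == z)%:R) :> R.
  transitivity (\sum_(x in C) \sum_(y in C) (m%:R * (M - M * (x == y)%:R - 2))).
    transitivity (\sum_(x in C) m%:R * (M * M - M - M * 2)).
      by rewrite sum1; ring.
    apply: eq_bigr => x xC; rewrite -mulr_sumr !sumrB -mulr_sumr sumeq // !sum1.
    by rewrite mulr1.
  apply: eq_bigr => x xC; apply: eq_bigr => y yC.
  rewrite -mulr_sumr !sumrB !sum1 !sumeq //; ring.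
apply: (@le_trans _ _ (\sum_(x in C) \sum_(y in C) \sum_(z in C)
    \sum_(i < n) (triffer x y z i)%:R)).
  apply: ler_sum => x xC; apply: ler_sum => y yC; apply: ler_sum => z zC.
  have -> : \sum_(i < n) (triffer x y z i)%:R = #|[set i | triffer x y z i]|%:R :> R.
    by rewrite -natr_sum -sum1dep_card [X in _ = X%:R]big_mkcond.
  have m0 : 0 <= m%:R :> R by [].
  have t0 : 0 <= #|[set i | triffer x y z i]|%:R :> R by [].
  have /forall_inP/(_ x xC)/forall_inP/(_ y yC)/forall_inP/(_ z zC) := hC.
  case: (x == y); case: (y == z); case: (x == z) => /=; rewrite -?(ler_nat R); lra.
rewrite (eq_bigr (fun x => \sum_(i < n) \sum_(y in C) \sum_(z in C)
    (triffer x y z i)%:R)) => [|x _]; last first.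
  by rewrite [RHS]exchange_big; apply: eq_bigr => y _; rewrite exchange_big.
rewrite exchange_big -[n in n%:R]card_ord mulr_natl -sumr_const.
by apply: ler_sum => i _; apply: sum_triffer_at_le.
Qed.

End UpperBound.

(** * Maximal sets without heavy pairs or bad triples *)

Lemma bad_triple_free_set (R : realFieldType) (V : finType)
    (bad : V -> V -> V -> bool) (q : R) :
  (forall x y z, bad x y z = bad y x z) ->
  (forall x y z, bad x y z = bad y z x) ->
  (forall x z, bad x x z) ->
  (0 < #|V|)%N -> 0 < q -> q < 1 ->
  (forall x, \sum_y #|[set z | bad x y z]|%:R <= (q * #|V|%:R) ^+ 2) ->
  exists2 C : {set V},
    {in C & C & C, forall x y z, [&& x != y, y != z & x != z] -> ~~ bad x y z}
    & 1 <= q * (#|C|%:R + #|C|%:R ^+ 2).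
Proof.
move=> swap rot degen V_gt0 q_gt0 q_lt1 hsum.
pose N : R := #|V|%:R; have N_gt0 : 0 < N by rewrite ltr0n.
pose B x y : R := #|[set z | bad x y z]|%:R.
pose heavy x y := q * N < B x y.
have heavyC x y : heavy x y = heavy y x.
  by rewrite /heavy /B; under eq_finset => z do rewrite swap.
have heavyxx x : heavy x x.
  rewrite /heavy /B (_ : [set z | bad x x z] = setT) ?cardsT ?gtr_pMl //.
  by apply/setP => z; rewrite !inE degen.
pose P (C : {set V}) := [forall x in C, forall y in C, (x != y) ==> ~~ heavy x y]
  && [forall x in C, forall y in C, forall z in C,
       [&& x != y, y != z & x != z] ==> ~~ bad x y z].
have PP (C : {set V}) : reflect ({in C &, forall x y, x != y -> ~~ heavy x y} /\
    {in C & C & C, forall x y z, [&& x != y, y != z & x != z] -> ~~ bad x y z}) (P C).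
  apply: (iffP andP) => -[h1 h2]; split.
  - by move=> x y xC yC; move/forall_inP/(_ x xC)/forall_inP/(_ y yC)/implyP: h1.
  - move=> x y z xC yC zC.
    by move/forall_inP/(_ x xC)/forall_inP/(_ y yC)/forall_inP/(_ z zC)/implyP: h2.
  - by apply/forall_inP => x xC; apply/forall_inP => y yC; apply/implyP; apply: h1.
  - apply/forall_inP => x xC; apply/forall_inP => y yC; apply/forall_inP => z zC.
    by apply/implyP; apply: h2.
have [C /maxsetP[/PP[C2 C3] Cmax]] : {C | maxset P C}.
  by apply: ex_maxset; exists set0; apply/PP; split => x; rewrite !inE.
exists C => //.
have cover w : (exists2 x, x \in C & heavy x w) \/
    exists x y, [/\ x \in C, y \in C, ~~ heavy x y & bad x y w].
  have [/exists_inP|] := boolP [exists x in C, heavy x w]; first by left.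
  rewrite negb_exists_in => /forall_inP light.
  have [/existsP[x /existsP[y /and4P[]]]|] :=
    boolP [exists x, exists y, [&& x \in C, y \in C, ~~ heavy x y & bad x y w]].
    by right; exists x, y.
  rewrite negb_exists => /forallP nobad.
  have fine x y : x \in C -> y \in C -> x != y -> ~~ bad x y w.
    move=> xC yC xy; have := nobad x; rewrite negb_exists => /forallP/(_ y).
    by rewrite xC yC C2.
  (* If nothing blocks [w], then [w |: C] still satisfies [P], so maximality puts [w] in [C]; but
     [w] is heavy with itself by [heavyxx], against [light]. *)
  suff wC : w \in C by have := light w wC; rewrite heavyxx.
  rewrite -(Cmax (w |: C)) ?setU11 ?subsetUr //; apply/PP; split.
    move=> x y /setU1P[->|xC] /setU1P[->|yC]; first by rewrite eqxx.
    - by move=> _; rewrite heavyC light.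
    - by move=> _; rewrite light.
    - exact: C2.
  move=> x y z /setU1P[->|xC] /setU1P[->|yC] /setU1P[->|zC];
    rewrite ?eqxx ?andbF // => /and3P[xy yz xz].
  - by rewrite rot fine.
  - by rewrite swap rot fine.
  - by rewrite fine.
  - by rewrite C3 ?xy ?yz ?xz.
(* Each heavy partner contributes more than [q * N] to a sum of at most [(q * N) ^+ 2]. *)
have heavy_le x : #|[set w | heavy x w]|%:R <= q * N.
  have qN : 0 < q * N by rewrite mulr_gt0.
  rewrite -(ler_pM2r qN) -expr2; apply: le_trans (hsum x).
  rewrite mulr_natl -sumr_const [leRHS](bigID [pred y | heavy x y]) /= -[leLHS]addr0.
  apply: lerD; last by apply: sumr_ge0.
  by under eq_bigl => w do rewrite inE; apply: ler_sum => y /ltW.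
(* Union bound: every set in either union has size at most [q * N], by [heavy_le] in the first and
   by lightness of the pair in the second. *)
have : setT \subset (\bigcup_(x in C) [set w | heavy x w]) :|:
    \bigcup_(x in C) \bigcup_(y in C | ~~ heavy x y) [set w | bad x y w].
  apply/subsetP => w _; apply/setUP.
  have [[x xC xw]|[x [y [xC yC xy xyw]]]] := cover w; [left|right].
    by apply/bigcupP; exists x; rewrite ?inE.
  apply/bigcupP; exists x => //; apply/bigcupP; exists y; rewrite ?inE ?yC //.
have card_bigcup (I : finType) (Q : pred I) (F : I -> {set V}) (b : R) :
    (forall i, Q i -> #|F i|%:R <= b) ->
    #|\bigcup_(i | Q i) F i|%:R <= \sum_(i | Q i) b.
  move=> hF; elim/big_rec2: _ => [|i A c Qi ih]; first by rewrite cards0.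
  apply: le_trans (lerD (hF i Qi) ih); rewrite -natrD ler_nat.
  exact: leq_card_setU.
move=> /subset_leq_card; rewrite cardsT => cardV.
rewrite -(ler_pM2r N_gt0) mul1r.
apply: le_trans (_ : (#|\bigcup_(x in C) [set w | heavy x w]| + _)%N%:R <= _).
  by rewrite ler_nat; apply: leq_trans cardV _; apply: leq_card_setU.
rewrite natrD.
have -> : q * (#|C|%:R + #|C|%:R ^+ 2) * N
  = #|C|%:R * (q * N) + #|C|%:R * (#|C|%:R * (q * N)) by ring.
have sumC (a : R) : #|C|%:R * a = \sum_(x in C) a by rewrite mulr_natl sumr_const.
rewrite !sumC.
apply: lerD; first exact: card_bigcup.
apply: (card_bigcup) => x xC.
apply: le_trans (card_bigcup _ _ _ (q * N) _) _ => [y /andP[_]|].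
  by rewrite -leNgt.
rewrite [leRHS](bigID [pred y | ~~ heavy x y]) /= lerDl.
by apply: sumr_ge0 => y _; rewrite mulr_ge0 // ltW.
Qed.

(** * Generating function and Chernoff bound *)

(** The weight factors over positions. Given the letter of [x], two of the nine letter pairs triffer
    with it and seven do not. *)
Lemma triffer_gf (R : comNzRingType) (n : nat) (x : word n) (t : R) :
  \sum_(y : word n) \sum_(z : word n) t ^+ #|[set i | triffer x y z i]|
    = (7 + 2 * t) ^+ n.
Proof.
pose D (a b c : 'I_3) : R := t ^+ [&& a != b, b != c & a != c].
have gf1 a : \sum_b \sum_c D a b c = 7 + 2 * t.
  rewrite !big_ord_recl !big_ord0 /D.
  by case: a => -[|[|[|//]]] ? /=; ring.
transitivity (\sum_(y : word n) \sum_(z : word n) \prod_i D (x i) (y i) (z i)).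
  apply: eq_bigr => y _; apply: eq_bigr => z _.
  rewrite -sum1_card -prodrXr big_mkcond /=; apply: eq_bigr => i _.
  by rewrite inE /D -trifferE; case: ifP.
transitivity (\sum_(y : word n) \prod_i \sum_c D (x i) (y i) c).
  by apply: eq_bigr => y _; rewrite bigA_distr_bigA.
rewrite -(bigA_distr_bigA (fun i b => \sum_c D (x i) b c)).
by under eq_bigr => i _ do rewrite gf1; rewrite prodr_const card_ord.
Qed.

(** Exponential Markov inequality: as [t <= 1], a pair with fewer than [m] triffering positions has
    weight at least [t ^+ m]. *)
Lemma triffer_tail (R : realFieldType) (n m : nat) (x : word n) (t : R) :
  0 < t -> t <= 1 ->
  (\sum_(y : word n) #|[set z : word n | (#|[set i | triffer x y z i]| < m)%N]|%:R)
    * t ^+ m <= (7 + 2 * t) ^+ n.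
Proof.
move=> t_gt0 t_le1; rewrite -(triffer_gf x) mulr_suml.
apply: ler_sum => y _; rewrite mulr_natl -sumr_const big_mkcond /=.
apply: ler_sum => z _; rewrite inE; case: ifP => [lt_m|_].
  by apply: ler_wiXn2l => //; [apply: ltW | apply: ltnW].
by rewrite exprn_ge0 // ltW.
Qed.

(** Both sides are compared through exponentials. The rate comes from [2/9 * eps - (2/9 - eps) * eps
    / (1 - eps) = 7/9 * eps ^+ 2 / (1 - eps)]. *)
Lemma chernoff_base (R : realType) (eps : R) (n m : nat) :
  0 < eps -> eps < 1 -> m%:R < (2 / 9 - eps) * n%:R ->
  (7 + 2 * (1 - eps)) ^+ n
    <= 9 ^+ n * expR (- (7 / 9 * eps ^+ 2 / (1 - eps)) * n%:R) * (1 - eps) ^+ m.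
Proof.
move=> e0 e1 hm; have d0 : 0 < 1 - eps by rewrite subr_gt0.
have h1 : 7 + 2 * (1 - eps) <= 9 * expR (- (2 / 9 * eps)).
  by have := expR_ge1Dx (- (2 / 9 * eps)); lra.
(* The inverse of [1 - eps] is [1 + eps / (1 - eps)]. *)
have h2 : expR (- (eps / (1 - eps))) <= 1 - eps.
  rewrite expRN invf_ple ?posrE ?expR_gt0 //.
  apply: le_trans (expR_ge1Dx _); rewrite le_eqVlt; apply/orP; left; apply/eqP.
  by field; rewrite gt_eqF.
apply: (@le_trans _ _ ((9 * expR (- (2 / 9 * eps))) ^+ n)).
  by apply: lerXn2r; rewrite ?nnegrE ?mulr_ge0 ?expR_ge0 //; lra.
rewrite exprMn -[leRHS]mulrA ler_pM2l ?exprn_gt0 //.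
apply: (@le_trans _ _ (expR (- (7 / 9 * eps ^+ 2 / (1 - eps)) * n%:R)
    * expR (- (eps / (1 - eps))) ^+ m)); last first.
  by rewrite ler_pM2l ?expR_gt0 // lerXn2r ?nnegrE ?expR_ge0 // ltW.
rewrite -!expRM_natl -expRD ler_expR -subr_ge0.
have -> : - (7 / 9 * eps ^+ 2 / (1 - eps)) * n%:R + m%:R * - (eps / (1 - eps))
    - n%:R * - (2 / 9 * eps)
  = eps / (1 - eps) * ((2 / 9 - eps) * n%:R - m%:R).
  by field; rewrite gt_eqF.
by rewrite mulr_ge0 ?divr_ge0 ?subr_ge0 // ltW.
Qed.

(** * The two bounds on [T n m] *)

Lemma T_upper (R : realFieldType) (eps : R) (n m : nat) :
  0 < eps -> (0 < n)%N -> (2 / 9 + eps) * n%:R < m%:R ->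
  (T n m)%:R <= 3 + 3 * (2 / 9 + eps) / eps.
Proof.
move=> e0 n_gt0 hm.
have K3 : 0 <= 3 * (2 / 9 + eps) / eps by apply: divr_ge0; lra.
rewrite /T; elim/big_ind: _ => [|a b ha hb|C hC].
- by apply: addr_ge0.
- by rewrite /maxn; case: ifP.
have := trifferent_count R hC; set M := #|C|%:R => count.
(* Replacing [m] by its lower bound in [m%:R * (M - 3)] needs [M - 3] positive; the summand 3 in the
   bound covers the other case. *)
have [M3|M3] := lerP M 3; first by apply: le_trans M3 _; rewrite lerDl.
have n0 : 0 < n%:R :> R by rewrite ltr0n.
suff : eps * M <= 3 * (2 / 9 + eps).
  by rewrite mulrC -ler_pdivlMr // => /le_trans -> //; rewrite lerDr.
have M2 : 0 < M ^+ 2 by rewrite exprn_gt0 //; lra.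
have : m%:R * (M - 3) <= n%:R * (2 / 9 * M).
  by rewrite -(ler_pM2r M2); lra.
have : (2 / 9 + eps) * n%:R * (M - 3) <= m%:R * (M - 3).
  by rewrite ler_pM2r ?subr_gt0 // ltW.
have : n%:R * ((2 / 9 + eps) * (M - 3)) <= n%:R * (2 / 9 * M) ->
    eps * M <= 3 * (2 / 9 + eps).
  by rewrite ler_pM2l //; lra.
by move=> red h1 h2; apply: red; lra.
Qed.

Lemma T_lower (R : realType) (eps : R) (n m : nat) :
  0 < eps -> eps < 1 -> (0 < m)%N -> (0 < n)%N ->
  m%:R < (2 / 9 - eps) * n%:R ->
  expR (7 / 54 * eps ^+ 2 / (1 - eps)) ^+ n <= (T n m)%:R.
Proof.
move=> e0 e1 m_gt0 n_gt0 hm.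
have d0 : 0 < 1 - eps by rewrite subr_gt0.
(* The factor [7 / 54] is one sixth of [7 / 9]: with [q = E ^- 3], the fraction [q ^+ 2 = E ^- 6] is
   the exponential factor in [chernoff_base]. *)
pose d := 7 / 54 * eps ^+ 2 / (1 - eps).
have d_gt0 : 0 < d by rewrite !mulr_gt0 ?invr_gt0 ?exprn_gt0.
pose E := expR d ^+ n; rewrite -/d -/E.
have E_gt0 : 0 < E by rewrite exprn_gt0 ?expR_gt0.
have E_gt1 : 1 < E by rewrite expr_gt1 ?expR_gt1 ?expR_ge0.
pose q := (E ^+ 3)^-1.
have E3_gt0 : 0 < E ^+ 3 by rewrite exprn_gt0.
have q_gt0 : 0 < q by rewrite invr_gt0.
have E3_gt1 : 1 < E ^+ 3 by rewrite expr_gt1 // ltW.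
have q_lt1 : q < 1 by rewrite invf_lt1.
pose bad (x y z : word n) := (#|[set i | triffer x y z i]| < m)%N.
have cardV : #|{: word n}|%:R = 3 ^+ n :> R by rewrite card_ffun !card_ord natrX.
have [C C3 hC] : exists2 C : {set word n},
    {in C & C & C, forall x y z, [&& x != y, y != z & x != z] -> ~~ bad x y z}
    & 1 <= q * (#|C|%:R + #|C|%:R ^+ 2).
  apply: bad_triple_free_set => //.
  - by move=> x y z; rewrite /bad; under eq_finset => i do rewrite triffer_swap.
  - by move=> x y z; rewrite /bad; under eq_finset => i do rewrite triffer_rot.
  (* A triple with a repeated word triffers nowhere, hence is bad because [m] is positive. *)
  - move=> x z; rewrite /bad; under eq_finset => i do rewrite trifferE eqxx.
    by rewrite (_ : [set _ | _] = set0) ?cards0 //; apply/setP => i; rewrite !inE.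
  - by rewrite card_ffun !card_ord expn_gt0.
  move=> x; rewrite cardV -(ler_pM2r (exprn_gt0 m d0)).
  apply: le_trans (triffer_tail m x d0 _) _; first lra.
  apply: le_trans (chernoff_base e0 e1 hm) _.
  rewrite le_eqVlt; apply/orP; left; apply/eqP; congr (_ * _).
  rewrite exprMn -exprM mulnC exprM mulrC (_ : 3 ^+ 2 = 9); last by ring.
  congr (_ * _); rewrite /q /E -!exprVn -!exprM -expRN -expRM_natl; congr expR.
  rewrite !natrM /d; field; rewrite gt_eqF //.
have /leq_T : trifferent m C.
  apply/forall_inP => x xC; apply/forall_inP => y yC; apply/forall_inP => z zC.
  by apply/implyP => /(C3 x y z xC yC zC); rewrite -leqNgt.
have := T_ge2 m n_gt0; rewrite -!(ler_nat R).
set t := (T n m)%:R; set c := #|C|%:R in hC * => t2 ct.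
have c0 : 0 <= c by rewrite ler0n.
(* Cubes are compared because [t + t ^+ 2 <= t ^+ 3] once [t >= 2]. *)
have : E ^+ 3 <= t ^+ 3.
  have : E ^+ 3 <= c + c ^+ 2.
    by move: hC; rewrite /q mulrC ler_pdivlMr // mul1r.
  move=> /le_trans; apply.
  apply: (@le_trans _ _ (t + t ^+ 2)).
    by apply: lerD => //; rewrite lerXn2r // nnegrE; lra.
  nra.
by rewrite ler_pXn2r // nnegrE; lra.
Qed.

Theorem theorem1p2 (R : realType) (eps : R) (eps_gt0 : 0 < eps) :
  (exists K : R, forall n m : nat, (1 <= m)%N -> (m <= n)%N ->
     (2 / 9 + eps) * n%:R < m%:R -> (T n m)%:R <= K)
  /\
  (exists2 delta : R, 0 < delta & forall n m : nat, (1 <= m)%N -> (m <= n)%N ->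
     m%:R < (2 / 9 - eps) * n%:R -> (1 + delta) ^+ n <= (T n m)%:R).
Proof.
split.
  exists (3 + 3 * (2 / 9 + eps) / eps) => n m m_gt0 mn.
  by apply: T_upper => //; apply: leq_trans mn.
(* The tilt [1 - eps] must be positive. For [eps >= 1] the range of [m] is empty and any [delta]
   works. *)
have [e1|e1] := lerP 1 eps.
  exists 1 => // n m _ _; rewrite ltNge (@le_trans _ _ 0) //.
  by rewrite mulr_le0_ge0 //; lra.
exists (expR (7 / 54 * eps ^+ 2 / (1 - eps)) - 1).
  by rewrite subr_gt0 expR_gt1 !mulr_gt0 ?invr_gt0 ?exprn_gt0 ?subr_gt0.
move=> n m m_gt0 mn hm; rewrite addrC subrK.
by apply: T_lower => //; apply: leq_trans mn.
Qed.
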